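(* Let $X$ be a nonempty set with basepoint $b\in X$, and let $(A^t)_{t\ge 0}$ be a max-plus linear semigroup with kernel on $X$ such that (i) $A^*(x,y)$ is finite for all $x,y\in X$, and (ii) for all $t\ge 0$ and $x,y\in X$, $A^t(x,y)=\sup_\gamma I(\gamma)$, where the supremum is over all paths $\gamma:[0,t]\to X$ from $x$ to $y$. Let $\mathscr{H}$ be the set of harmonic functions. Then the normalised extremal generators of $\mathscr{H}$ are precisely the elements of the minimal boundary $\mathscr{M}^m$.
   Context: Semigroup. Write $\mathbb{R}_{\max}=\mathbb{R}\cup\{-\infty\}$ and $\overline{\mathbb{R}}_{\max}=\mathbb{R}\cup\{\pm\infty\}$, with $-\infty$ absorbing for addition; suprema of empty sets are $-\infty$. A max-plus linear semigroup with kernel on a set $X$ is a family $(A^t)_{t\ge0}$ of operators from $\overline{\mathbb{R}}_{\max}^X$ to itself such that each $A^t$ has the form $A^tg(x)=\sup_{y\in X}(A^t(x,y)+g(y))$ for some kernel $(x,y)\mapsto A^t(x,y)\in\overline{\mathbb{R}}_{\max}$, with $A^0=I$ (the identity operator, with kernel $0$ if $x=y$ and $-\infty$ otherwise) and $A^{s+t}=A^sA^t$ (composition) for all $s,t\ge0$. Equivalently to the last property, $A^{s+t}(x,y)=\sup_{z\in X}(A^s(x,z)+A^t(z,y))$. A function $\phi:X\to\mathbb{R}_{\max}$ is harmonic if $A^t\phi=\phi$ for all $t\ge0$. Martin space. Put $A^*=\sup_{t\ge0}A^t$, i.e. $A^*(x,y)=\sup_{t\ge 0}A^t(x,y)$.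 The Martin kernel is $K(x,y)=A^*(x,y)-A^*(b,y)$. The Martin space $\mathscr{M}$ is the closure of $\mathscr{K}=\{K(\cdot,y)\mid y\in X\}\subset\mathbb{R}^X$ in the topology of pointwise convergence (with the induced topology). For $\xi:X\to\mathbb{R}_{\max}$ and $\eta\in\mathscr{M}$, $$\mu_\xi(\eta):=\inf_{W\ni\eta}\ \sup_{x\in X,\ K(\cdot,x)\in W}\left(A^*(b,x)+\xi(x)\right),$$ the infimum being over all neighbourhoods $W$ of $\eta$ in $\mathscr{M}$. For $\eta,\xi\in\mathscr{M}$ set $H(\eta,\xi):=\mu_\xi(\eta)$. The minimal boundary $\mathscr{M}^m$ is the set of $\xi\in\mathscr{M}$ that are harmonic and satisfy $H(\xi,\xi)=0$. Paths. A path is an arbitrary map $\gamma$ from a closed interval of $\mathbb{R}_+=[0,\infty)$ to $X$. For $t_0<t_1<\dots<t_n$ in the domain of $\gamma$, $I(t_0,\dots,t_n;\gamma):=\sum_{i=0}^{n-1}A^{t_{i+1}-t_i}(\gamma(t_i),\gamma(t_{i+1}))$. The reward of $\gamma:[s_0,s_1]\to X$ is $I(\gamma):=\inf I(t_0,\dots,t_n;\gamma)$, the infimum being over all finite increasing sequences in $[s_0,s_1]$ with $t_0=s_0$ and $t_n=s_1$. Extremal generators. Let $V$ be a set of functions from $X$ to $\mathbb{R}_{\max}$ closed under (pointwise) maximisation and the addition of a constant. A function $f:X\to\mathbb{R}$ is normalised if $f(b)=0$. A function $f\in V$ with $f:X\to\mathbb{R}$ is an extremal generator of $V$ if $f=\max(u,v)$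 with $u,v\in V$ implies that $f=u$ or $f=v$. *)

(* Defs.v *)
From HB Require Import structures.
From mathcomp Require Import all_boot all_order all_algebra.
From mathcomp Require Import all_classical all_reals all_analysis.

Set Implicit Arguments.
Unset Strict Implicit.
Unset Printing Implicit Defensive.

Import Order.TTheory GRing.Theory Num.Theory.
Import numFieldNormedType.Exports.

Local Open Scope classical_set_scope.
Local Open Scope ring_scope.
Local Open Scope ereal_scope.

(* All max-plus arithmetic takes place in [\bar R], whose addition has -oo as
   an absorbing element (-oo + +oo = -oo) and where [ereal_sup set0 = -oo].
   A family (A^t)_{t >= 0} is a map [A : R -> X -> X -> \bar R] giving the
   kernels; its values at t < 0 are never used. *)

Section MaxPlusSemigroup.
Context {R : realType} {X : Type}.

Definition kernel_op (k : X -> X -> \bar R) (g : X -> \bar R) : X -> \bar R :=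
  fun x => ereal_sup [set k x y + g y | y in [set: X]].

Definition maxplus_semigroup (A : R -> X -> X -> \bar R) : Prop :=
  (forall g, kernel_op (A 0%R) g = g) /\
  (forall s t : R, (0 <= s)%R -> (0 <= t)%R ->
    forall g, kernel_op (A (s + t)%R) g = kernel_op (A s) (kernel_op (A t) g)).

Definition maxplus_harmonic (A : R -> X -> X -> \bar R) (phi : X -> \bar R) :
    Prop :=
  (forall x, phi x != +oo) /\
  (forall t : R, (0 <= t)%R -> kernel_op (A t) phi = phi).

Definition kernel_star (A : R -> X -> X -> \bar R) (x y : X) : \bar R :=
  ereal_sup [set A t x y | t in [set t : R | (0 <= t)%R]].

(* [itv_partition s0 s1 s] says that [s0 :: s] increases strictly from s0 to
   s1; for s0 = s1 this forces [s = [::]], and the reward is the empty sum. *)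
Definition path_sum (A : R -> X -> X -> \bar R) (s0 : R) (gamma : R -> X)
    (s : seq R) : \bar R :=
  let t := nth s0 (s0 :: s) in
  \sum_(0 <= i < size s) A (t i.+1 - t i)%R (gamma (t i)) (gamma (t i.+1)).

(* Only the values of [gamma] on [s0, s1] matter: a path is represented by any
   extension of it to R. *)
Definition path_reward (A : R -> X -> X -> \bar R) (s0 s1 : R)
    (gamma : R -> X) : \bar R :=
  ereal_inf [set path_sum A s0 gamma s | s in itv_partition s0 s1].

End MaxPlusSemigroup.

Section MartinSpace.
Context {R : realType} {X : Type}.
Variables (A : R -> X -> X -> \bar R) (b : X).

(* Real-valued, hence meaningful only when [kernel_star A] is finite. *)
Definition martin_kernel (x y : X) : R :=
  fine (kernel_star A x y - kernel_star A b y).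

Definition martin_column (y : X) : {ptws X -> R} := fun x => martin_kernel x y.

Definition martin_space : set {ptws X -> R} := closure (range martin_column).

(* [within martin_space (nbhs eta)] is the neighbourhood filter of [eta] in the
   induced topology; its members may have extra points outside the Martin
   space, but these are never of the form [martin_column x]. *)
Definition martin_mu (xi : X -> \bar R) (eta : {ptws X -> R}) : \bar R :=
  ereal_inf
    [set ereal_sup [set kernel_star A b x + xi x |
                     x in [set x | W (martin_column x)]]
    | W in within martin_space (nbhs eta)].

Definition martin_H (eta xi : {ptws X -> R}) : \bar R :=
  martin_mu (EFin \o xi) eta.

Definition minimal_boundary : set {ptws X -> R} :=
  [set xi | [/\ martin_space xi, maxplus_harmonic A (EFin \o xi)
              & martin_H xi xi = 0]].

End MartinSpace.

Section ExtremalGenerators.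
Context {R : realType} {X : Type}.

Definition extremal_generator (V : set (X -> \bar R)) (f : X -> R) : Prop :=
  V (EFin \o f) /\
  (forall u v, V u -> V v -> EFin \o f = (fun x => maxe (u x) (v x)) ->
     EFin \o f = u \/ EFin \o f = v).

Definition normalised (b : X) (f : X -> R) : Prop := f b = 0%R.

End ExtremalGenerators.

(* Main.v *)
Require Import Defs.
From mathcomp Require Import all_boot all_order all_algebra.
From mathcomp Require Import all_classical all_reals all_analysis.
From mathcomp Require Import lra.

Import Order.TTheory GRing.Theory Num.Theory.
Import numFieldNormedType.Exports.

Local Open Scope classical_set_scope.
Local Open Scope ring_scope.
Local Open Scope ereal_scope.

(** Write [a x y] for the (real) value of [A^*] at [(x, y)].  Since
[a x y + a y z <= a x z], the column of [y] in the Martin kernel takes its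
value at [x] in the compact interval [[a x b, - a b x]].

Minimal elements are extremal.  The functional [martin_mu] turns a pointwise
maximum into a maximum ([martin_mu_max]), because it is an upper limit along a
filter.  So if [xi = max(u, v)] and [H(xi, xi) = 0], one of [u], [v], say [u],
has nonnegative mass at [xi].  A superharmonic function dominates each point at
which its mass is nonnegative ([superharmonic_ge_mu]), whence [xi <= u], and so
[u = xi].

Extremal generators are minimal.  Say that a set of states [V] determines the
harmonic function [f] when [f <= A^*(f restricted to V)].  The heart of the
proof is [extremal_determined]: if the union of [V] and [W] determines an
extremal [f], then [V] or [W] does.  For any [V], the supremum [f_V] of the
harmonic functions that are below [A^*(f restricted to V)] is harmonic, and [V]
determines [f] if and only if [f_V = f]; so it suffices to see that
[f = max(f_V, f_W)].  Start at [x] with a target [c < f x].  As [f = A^1 f] and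
the union of [V] and [W] determines [f], one can travel for a time at least 1 to
a state of this union in such a way that the target, once the reward of the trip
is deducted, lies below the value of [f] there; repeat this forever.  The best
value of reward plus remaining target obtained by joining the chain of visited
states from [z], at whatever stage, is a harmonic function of [z]: the chain
lasts for an infinite time, so that joining it can be put off beyond any given
date.  This function is at least [c] at [x], and it is carried by whichever of
[V], [W] the chain visits infinitely often.

Consequently the sets of states whose complement does not determine [f] form a
proper filter.  By compactness its image in the Martin space has a cluster point
[eta], and every neighbourhood of [eta] then determines [f].  Shrinking the
neighbourhood to [eta] in [f x <= sup_y (K(x, y) + a b y + f y)], where
[a b y + f y <= f b = 0], gives [f <= eta] as well as [martin_mu f eta = 0]
(take [x = b]); the latter gives [eta <= f].  Hence [f = eta], and
[H(f, f) = 0]. *)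

(** * The kernel of the semigroup and its supremum *)

Section Semigroup.
Set Implicit Arguments.
Unset Strict Implicit.
Context {R : realType} {X : Type} {A : R -> X -> X -> \bar R}.
Context (semigroupA : maxplus_semigroup A).
Context (finA : forall x y : X, kernel_star A x y \is a fin_num).
Implicit Types (x y z : X) (s t : R) (u : X -> \bar R) (f : X -> R).
Implicit Types (V W : set X).

(* The max-plus Dirac function, through which the identities between operators
   become identities between kernels. *)
Let delta z : X -> \bar R := fun y => if `[< y = z >] then 0 else -oo.

Lemma kernel_op_delta (k : X -> X -> \bar R) z :
  kernel_op k (delta z) = k ^~ z.
Proof.
apply/funext => x; apply/eqP; rewrite eq_le; apply/andP; split.
  apply/ereal_supP => _ [y _ <-]; rewrite /delta.
  by case: asboolP => [->|_]; rewrite ?adde0 // addeNy leNye.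
apply: ereal_sup_ubound; exists z => //.
by rewrite /delta; case: asboolP => // _; rewrite adde0.
Qed.

Lemma semigroup_comp s t x z : (0 <= s)%R -> (0 <= t)%R ->
  A (s + t) x z = ereal_sup [set A s x y + A t y z | y in [set: X]].
Proof.
move=> s0 t0; have := semigroupA.2 s t s0 t0 (delta z).
by rewrite !kernel_op_delta => /(congr1 (fun h => h x)).
Qed.

Lemma semigroup_zero x : A 0%R x x = 0.
Proof.
have := semigroupA.1 (delta x); rewrite kernel_op_delta.
by move=> /(congr1 (fun h => h x)) ->; rewrite /delta; case: asboolP.
Qed.

Definition astar x y : R := fine (kernel_star A x y).

Lemma kernel_starE x y : kernel_star A x y = (astar x y)%:E.
Proof. by rewrite fineK. Qed.

Lemma semigroup_le_star t x y : (0 <= t)%R -> A t x y <= (astar x y)%:E.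
Proof.
by move=> t0; rewrite -kernel_starE; apply: ereal_sup_ubound; exists t.
Qed.

Lemma semigroup_fin t x y (c : R) : (0 <= t)%R -> c%:E < A t x y ->
  exists2 r, A t x y = r%:E & (c < r)%R.
Proof.
move=> /(semigroup_le_star x y); case: (A t x y) => // r _ cr.
by exists r; rewrite // -lte_fin.
Qed.

Lemma star_approx x y (c : R) : (c < astar x y)%R ->
  exists t r, [/\ (0 <= t)%R, A t x y = r%:E & (c < r)%R].
Proof.
rewrite -lte_fin -kernel_starE => /ereal_sup_gt[_ [t t0 <-]] ct.
by have [r Ar cr] := semigroup_fin t0 ct; exists t, r.
Qed.

Lemma semigroup_comp_ge s t x y z (p q : R) : (0 <= s)%R -> (0 <= t)%R ->
  A s x y = p%:E -> A t y z = q%:E -> (p + q)%:E <= A (s + t) x z.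
Proof.
move=> s0 t0 Ap Aq; rewrite semigroup_comp // EFinD -Ap -Aq.
by apply: ereal_sup_ubound; exists y.
Qed.

Lemma star_triangle x y z : (astar x y + astar y z <= astar x z)%R.
Proof.
apply/ler_addgt0Pl => e e0.
have [|s [p [s0 Ap pe]]] := @star_approx x y (astar x y - e / 2)%R; first by lra.
have [|t [q [t0 Aq qe]]] := @star_approx y z (astar y z - e / 2)%R; first by lra.
have := semigroup_comp_ge s0 t0 Ap Aq.
move=> /le_trans /(_ (semigroup_le_star _ _ (addr_ge0 s0 t0))).
by rewrite lee_fin; lra.
Qed.

Lemma star_diag x : astar x x = 0%R.
Proof.
have := semigroup_le_star x x (lexx 0%R); rewrite semigroup_zero lee_fin.
by have := star_triangle x x x; lra.
Qed.

(** * Harmonic functions *)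

(** For a function that never takes the value [+oo], this amounts to
[A^t u <= u] for every [t >= 0]. *)
Definition superharmonic u := forall x y, (astar x y)%:E + u y <= u x.

Lemma harmonicE u t x : maxplus_harmonic A u -> (0 <= t)%R ->
  u x = ereal_sup [set A t x y + u y | y in [set: X]].
Proof. by move=> [_ uA] /uA/(congr1 (fun h => h x)). Qed.

(** A value [-oo] of [u] makes the inequality trivial and a real one can be moved
to the other side, which leaves a bound on the supremum [A^*]. *)
Lemma harmonic_superharmonic u : maxplus_harmonic A u -> superharmonic u.
Proof.
move=> uH x y; case uy : (u y) => [r| |].
- rewrite -leeBrDr // -kernel_starE; apply/ereal_supP => _ [t t0 <-].
  rewrite leeBrDr // -uy (harmonicE x uH t0).
  by apply: ereal_sup_ubound; exists y.
- by have := uH.1 y; rewrite uy.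
- by rewrite addeNy leNye.
Qed.

(** The two inequalities between [u] and [A^t u], the second one tested on the
real numbers below [u x] only, so that suprema can be treated by means of
approximating elements. *)
Lemma harmonic_criterion u : (forall x, u x != +oo) -> superharmonic u ->
  (forall t x (c : R), (0 <= t)%R -> c%:E < u x ->
     exists y, c%:E <= A t x y + u y) ->
  maxplus_harmonic A u.
Proof.
move=> uoo usup uA; split=> // t t0; apply/funext => x.
apply/eqP; rewrite eq_le; apply/andP; split.
  apply/ereal_supP => _ [y _ <-]; apply: le_trans (usup x y).
  by apply: leeD => //; exact: semigroup_le_star.
case ux : (u x) => [r| |]; last by rewrite leNye.
  apply/lee_subgt0Pr => e e0; have [|y] := uA t x (r - e)%R t0.
    by rewrite ux lte_fin ltrBlDr ltrDl.
  by move=> /le_trans; apply; apply: ereal_sup_ubound; exists y.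
by have := uoo x; rewrite ux.
Qed.

(** Max-plus linear operators commute with arbitrary suprema. *)
Lemma harmonic_sup (S : set (X -> \bar R)) :
  (forall u, S u -> maxplus_harmonic A u) ->
  (forall x, ereal_sup [set u x | u in S] != +oo) ->
  maxplus_harmonic A (fun x => ereal_sup [set u x | u in S]).
Proof.
move=> SH Soo; apply: harmonic_criterion => //.
  move=> x y; rewrite addeC -leeBrDr //; apply/ereal_supP => _ [u Su <-].
  rewrite leeBrDr // addeC.
  apply: (le_trans (harmonic_superharmonic (SH _ Su) x y)).
  by apply: ereal_sup_ubound; exists u.
move=> t x c t0 /ereal_sup_gt[_ [u Su <-]].
rewrite (harmonicE x (SH _ Su) t0) => /ereal_sup_gt[_ [y _ <-]] cy.
exists y; apply: (le_trans (ltW cy)); apply: leeD => //.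
by apply: ereal_sup_ubound; exists u.
Qed.

(** * Reduction of a harmonic function to a set of states *)

(** This is the inequality [u <= A^*(f restricted to V)]. *)
Definition carried f V u :=
  forall x (c : R), c%:E < u x -> exists2 y, V y & (c < astar x y + f y)%R.

Definition determined f V := carried f V (EFin \o f).

Lemma harmonic_real_le f x y : maxplus_harmonic A (EFin \o f) ->
  (astar x y + f y <= f x)%R.
Proof. by move=> /harmonic_superharmonic /(_ x y); rewrite /= -EFinD lee_fin. Qed.

Lemma carried_le f V u : maxplus_harmonic A (EFin \o f) -> carried f V u ->
  forall x, u x <= (f x)%:E.
Proof.
move=> fH uV x; have {}uV c : c%:E < u x -> (c <= f x)%R.
  by move=> /uV[y _ /ltW]/le_trans; apply; exact: harmonic_real_le.
case: (u x) uV => [r| |] uV; last by rewrite leNye.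
  rewrite lee_fin; apply/ler_addgt0Pl => e e0.
  by have := uV (r - e)%R; rewrite lte_fin; lra.
by have /uV := ltry (f x + 1)%R; rewrite gerDl ler10.
Qed.

(** One trip of the chain: a unit of time, permitted by [f = A^1 f], and then the
time needed to reach [V]; [d] is what remains of the target [c] on arrival.  The
strict inequality [c < f x] leaves room for both approximations and is itself
passed on to the arrival, so that no error budget has to be shared among the
trips. *)
Lemma determined_step f V x (c : R) : maxplus_harmonic A (EFin \o f) ->
  determined f V -> (c < f x)%R ->
  exists y d t, [/\ V y, (d < f y)%R, (1 <= t)%R & c%:E <= A t x y + d%:E].
Proof.
move=> fH fV cx.
have : c%:E < (EFin \o f) x by [].
rewrite (harmonicE x fH ler01).
move=> /ereal_sup_gt[_ [w _ <-]] /=; rewrite -lteBlDr // -EFinB => cw.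
have [p Ap cp] := semigroup_fin ler01 cw.
have [|y Vy] := fV w (c - p)%R; first by rewrite lte_fin; lra.
rewrite -ltrBlDr => /star_approx[t [q [t0 Aq cq]]].
exists y, (c - (p + q))%R, (1 + t)%R; split=> //; [lra|lra|].
rewrite -[c in leLHS](subrKC (p + q)%R) EFinD.
by apply: leeD => //; exact: semigroup_comp_ge Ap Aq.
Qed.

(** For harmonic [f], the greatest harmonic function below
[A^*(f restricted to V)]. *)
Definition reduction f V x : \bar R :=
  ereal_sup [set u x | u in [set u | maxplus_harmonic A u /\ carried f V u]].

Lemma reduction_carried f V : carried f V (reduction f V).
Proof. by move=> x c /ereal_sup_gt[_ [u [_ uV] <-]]; exact: uV. Qed.

Lemma reduction_harmonic f V : maxplus_harmonic A (EFin \o f) ->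
  maxplus_harmonic A (reduction f V).
Proof.
move=> fH; apply: harmonic_sup => [u []//|x].
by rewrite -ltey (le_lt_trans (carried_le fH (@reduction_carried f V) x)) ?ltry.
Qed.

(** * The harmonic function attached to a chain *)

(** Since joining the chain later is never worse, the supremum is also the limit
along the chain: a Busemann-like function. *)
Definition chain_value (y : nat -> X) (d : nat -> R) z : \bar R :=
  ereal_sup [set (astar z (y n) + d n)%:E | n in [set: nat]].

Section Chain.
Context (f : X -> R) (y : nat -> X) (d t : nat -> R).
Context (fH : maxplus_harmonic A (EFin \o f)).
Context (df : forall n, (d n < f (y n))%R).
Context (t1 : forall n, (1 <= t n)%R).
Context (stepA : forall n, (d n)%:E <= A (t n) (y n) (y n.+1) + (d n.+1)%:E).

Let step n : exists2 q, A (t n) (y n) (y n.+1) = q%:E & (d n <= q + d n.+1)%R.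
Proof.
have := stepA n.
have := @semigroup_le_star (t n) (y n) (y n.+1) (le_trans ler01 (t1 n)).
by case: (A _ _ _) => // q _; rewrite -EFinD lee_fin; exists q.
Qed.

(** It pays to join the chain later: by [stepA], the reward of the move from
[y n] to [y n.+1] makes up for the decrease of the remaining target. *)
Lemma chain_star_le z m n : (m <= n)%N ->
  (astar z (y m) + d m <= astar z (y n) + d n)%R.
Proof.
move=> /subnK <-; elim: (n - m)%N => // k IH; apply: (le_trans IH).
rewrite addSn; move: (k + m)%N => {IH} j; have [q Aq dq] := step j.
have := @semigroup_le_star (t j) (y j) (y j.+1) (le_trans ler01 (t1 j)).
by rewrite Aq lee_fin; have := star_triangle z (y j) (y j.+1); lra.
Qed.

(** The trips last at least one unit of time each, so a value close to the
supremum can be reached by joining the chain after any given date [s]. *)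
Lemma chain_late_approx z (c s : R) : c%:E < chain_value y d z ->
  exists n r q,
    [/\ (s <= r)%R, (0 <= r)%R, A r z (y n) = q%:E & (c < q + d n)%R].
Proof.
move=> /ereal_sup_gt[_ [n0 _ <-]]; rewrite lte_fin -ltrBlDr => /star_approx.
move=> [r0 [q0 [r00 Aq0 cq0]]].
have H k : exists n r q,
    [/\ (k%:R <= r)%R, A r z (y n) = q%:E & (c < q + d n)%R].
  elim: k => [|k [n [r [q [kr Aq cq]]]]].
    by exists n0, r0, q0; split=> //; lra.
  have [p Ap dp] := step n.
  have r0' : (0 <= r)%R by apply: le_trans kr.
  have t0 : (0 <= t n)%R := le_trans ler01 (t1 n).
  have cmp := semigroup_comp_ge r0' t0 Aq Ap.
  have /(semigroup_fin (addr_ge0 r0' t0)) [w Aw cw] :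
      (c - d n.+1)%:E < A (r + t n) z (y n.+1).
    by apply: lt_le_trans cmp; rewrite lte_fin; lra.
  exists n.+1, (r + t n)%R, w; split=> //; last by lra.
  by rewrite -natr1 lerD.
have [n [r [q [kr Aq cq]]]] := H (Num.bound `|s|).
exists n, r, q; split=> //; last by apply: le_trans kr.
apply: le_trans kr; apply: ltW; apply: le_lt_trans (ler_norm s) _.
exact: archi_boundP.
Qed.

(** The upper bound by [A^s] comes from cutting at time [s] a way of joining the
chain that takes longer than [s]. *)
Lemma chain_harmonic : maxplus_harmonic A (chain_value y d).
Proof.
apply: harmonic_criterion.
- move=> x; rewrite -ltey; apply: le_lt_trans (ltry (f x)).
  apply/ereal_supP => _ [n _ <-]; rewrite lee_fin.
  by have := harmonic_real_le x (y n) fH; have := df n; lra.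
- move=> x z; rewrite addeC -leeBrDr //; apply/ereal_supP => _ [n _ <-].
  rewrite leeBrDr // -EFinD; apply: le_trans; last first.
    by apply: ereal_sup_ubound; exists n.
  by rewrite lee_fin; have := star_triangle x z (y n); lra.
move=> s x c s0 /(@chain_late_approx x c s)[n [r [q [sr r0 Aq cq]]]].
have rs0 : (0 <= r - s)%R by rewrite subr_ge0.
have : (c - d n)%:E < A r x (y n) by rewrite Aq lte_fin; lra.
rewrite -[r](subrKC s) semigroup_comp // => /ereal_sup_gt[_ [w _ <-]] cw.
exists w; have [p Ap cp] : exists2 p, A s x w = p%:E &
    (c - d n < p + astar w (y n))%R.
  move: cw (semigroup_le_star x w s0) (semigroup_le_star w (y n) rs0).
  case: (A s x w) => // p; case: (A _ w _) => // p'.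
  by rewrite -EFinD !lee_fin lte_fin => *; exists p => //; lra.
apply: (@le_trans _ _ (p%:E + (astar w (y n) + d n)%:E)).
  by rewrite -EFinD lee_fin; lra.
by rewrite Ap leeD //; apply: ereal_sup_ubound; exists n.
Qed.

Lemma chain_carried V : (forall n, exists2 m, (n <= m)%N & V (y m)) ->
  carried f V (chain_value y d).
Proof.
move=> yV x c /ereal_sup_gt[_ [n _ <-]]; rewrite lte_fin => cn.
have [m nm ym] := yV n; exists (y m) => //.
by have := chain_star_le x nm; have := df m; lra.
Qed.

End Chain.

Lemma infinitely_often_or (P Q : nat -> Prop) : (forall n, P n \/ Q n) ->
  (forall n, exists2 m, (n <= m)%N & P m) \/
  (forall n, exists2 m, (n <= m)%N & Q m).
Proof.
move=> PQ; have [?|/existsNP[n Pn]] :=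
  pselect (forall n, exists2 m, (n <= m)%N & P m).
  by left.
right=> k; exists (maxn n k); first exact: leq_maxr.
have [Pm|//] := PQ (maxn n k).
by exfalso; apply: Pn; exists (maxn n k) => //; exact: leq_maxl.
Qed.

(** An infinite chain in the union of [V] and [W] visits one of the two infinitely
often; the attached harmonic function is carried by that one. *)
Lemma determined_le_reduction f V W : maxplus_harmonic A (EFin \o f) ->
  determined f (V `|` W) ->
  forall x, (f x)%:E <= maxe (reduction f V x) (reduction f W x).
Proof.
move=> fH fVW x; apply/lee_subgt0Pr => e e0; set c := (f x - e)%R.
(* Pairs (state, target); the step is only constrained from pairs whose target
   is below [f], a condition which [chf] shows to persist along the chain. *)
have step (p : X * R) : {q : X * R | (p.2 < f p.1)%R ->
    [/\ (V `|` W) q.1, (q.2 < f q.1)%R &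
     exists2 t, (1 <= t)%R & p.2%:E <= A t p.1 q.1 + q.2%:E]}.
  apply: cid; have [dp|dp] := pselect (p.2 < f p.1)%R; last by exists p.
  have [y [d [t [Vy dy t1 Ad]]]] := determined_step fH fVW dp.
  by exists (y, d) => _; split=> //; exists t.
have [ch [ch0 chS]] := dependent_choice step (x, c).
have chf n : ((ch n).2 < f (ch n).1)%R.
  elim: n => [|n IH]; last by have [] := chS n IH.
  by rewrite ch0 /= /c; lra.
have /choice[t tP] n : exists t, (1 <= t)%R /\
    (ch n).2%:E <= A t (ch n).1 (ch n.+1).1 + (ch n.+1).2%:E.
  by have [_ _ [t]] := chS n (chf n); exists t.
have t1 n := (tP n).1; have stepA n := (tP n).2.
set u := chain_value (fst \o ch) (snd \o ch).
have uH : maxplus_harmonic A u := chain_harmonic fH chf t1 stepA.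
have ux : c%:E <= u x.
  apply: ereal_sup_ubound; exists 0%N => //.
  by rewrite /= ch0 star_diag add0r.
(* The start [x] may lie outside both sets, hence the shift by one. *)
have red U : (forall n, exists2 m, (n <= m)%N & U (ch m.+1).1) ->
    c%:E <= reduction f U x.
  move=> chU; apply: (le_trans ux); apply: ereal_sup_ubound; exists u => //.
  split=> //; apply: (chain_carried chf t1 stepA) => n.
  by have [m nm Um] := chU n; exists m.+1 => //; exact: leqW.
rewrite -EFinB le_max.
have [|/red ->|/red ->] := @infinitely_often_or
  (fun n => V (ch n.+1).1) (fun n => W (ch n.+1).1).
- by move=> n; have [] := chS n (chf n).
- by [].
- by rewrite orbT.
Qed.

(** For an extremal generator, being determined is a prime property of sets of
states, just as membership in an ultrafilter is. *)
Lemma extremal_determined f V W :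
  extremal_generator (maxplus_harmonic A) f ->
  determined f (V `|` W) -> determined f V \/ determined f W.
Proof.
move=> [fH fext] fVW.
have [|fV|fW] := fext _ _ (reduction_harmonic V fH) (reduction_harmonic W fH).
- apply/funext => x; apply/eqP; rewrite eq_le determined_le_reduction //=.
  by rewrite ge_max !(carried_le fH (@reduction_carried f _)).
- by left; rewrite /determined fV; exact: reduction_carried.
- by right; rewrite /determined fW; exact: reduction_carried.
Qed.

(** * The Martin space *)

Section Martin.
Context (b : X).
Implicit Types (eta : {ptws X -> R}).

Lemma martin_columnE x y : martin_column A b y x = (astar x y - astar b y)%R.
Proof. by rewrite /martin_column /martin_kernel fineB. Qed.

Lemma eval_nbhs eta x (B : set R) : nbhs (eta x) B ->
  nbhs eta [set h : {ptws X -> R} | B (h x)].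
Proof. exact: (@proj_continuous {classic X} (fun=> R) x eta). Qed.

Lemma eval_nbhs_gt eta x (c : R) : (c < eta x)%R ->
  nbhs eta [set h : {ptws X -> R} | (c < h x)%R].
Proof.
by move=> cx; apply: (@eval_nbhs eta x [set r | (c < r)%R]); exact: lt_nbhsr.
Qed.

Lemma eval_nbhs_lt eta x (c : R) : (eta x < c)%R ->
  nbhs eta [set h : {ptws X -> R} | (h x < c)%R].
Proof.
by move=> cx; apply: (@eval_nbhs eta x [set r | (r < c)%R]); exact: lt_nbhsl.
Qed.

Lemma martin_space_normalised eta : martin_space A b eta -> normalised b eta.
Proof.
move=> etaM; apply/eqP; rewrite eq_le.
apply/andP; split; rewrite leNgt; apply/negP.
  move=> /eval_nbhs_gt/etaM[_ [[y _ <-]]] /=.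
  by rewrite martin_columnE subrr ltxx.
move=> /eval_nbhs_lt/etaM[_ [[y _ <-]]] /=.
by rewrite martin_columnE subrr ltxx.
Qed.

(** Compactness of the Martin space, in terms of filters of states: the columns
lie in a product of compact intervals. *)
Lemma martin_column_cluster (F : set_system X) : ProperFilter F ->
  exists2 eta, martin_space A b eta &
    forall U, nbhs eta U -> ~ F [set y | ~ U (martin_column A b y)].
Proof.
move=> FF.
pose B := [set h : {ptws X -> R} |
  forall x, [set` `[astar x b, (- astar b x)%R]] (h x)].
have cB : compact B.
  pose I x := [set` `[astar x b, (- astar b x)%R]].
  apply: (@tychonoff {classic X} (fun=> R) I) => x.
  exact: segment_compact.
have colB y : B (martin_column A b y).
  move=> x /=; rewrite in_itv /= martin_columnE.
  by have := star_triangle x b y; have := star_triangle b x y; lra.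
(* [eta] adheres to the range of the columns, which the image filter contains. *)
have [eta [_ etaC]] : B `&` cluster (martin_column A b @ F) !=set0.
  apply: cB; apply: (@filterS _ F _ setT) => [y _|]; last exact: filterT.
  exact: colB.
exists eta => [U /etaC|U /etaC etaU FU].
  move=> /(_ (range (martin_column A b))) [|h [hr Uh]]; last by exists h.
  by apply: (@filterS _ F _ setT) => [y _|]; [exists y|exact: filterT].
have [|h [nU Uh]] := etaU (~` U); first exact: FU.
exact: nU.
Qed.

(** For [y] with [K(., y)] close to [eta], superharmonicity reads
[u x >= K(x, y) + (a b y + u y)], where the first term is nearly [eta x] and the
second one can be taken nearly nonnegative. *)
Lemma superharmonic_ge_mu u eta : (forall x, u x != +oo) -> superharmonic u ->
  0 <= martin_mu A b u eta -> forall x, (eta x)%:E <= u x.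
Proof.
move=> uoo usup mu0 x; apply/lee_subgt0Pr => e e0.
pose U := [set h : {ptws X -> R} | (eta x - e / 2 < h x)%R].
have Un : nbhs eta U by apply: eval_nbhs_gt; lra.
have : (- (e / 2))%:E < ereal_sup [set kernel_star A b y + u y |
    y in [set y | U (martin_column A b y)]].
  apply: lt_le_trans (le_trans mu0 _); first by rewrite lte_fin; lra.
  apply: ereal_inf_lbound; exists U => //.
  by apply: filterS Un => h Uh _.
move=> /ereal_sup_gt[_ [y Uy <-]]; rewrite kernel_starE.
move: Uy; rewrite /U /= martin_columnE => Uy.
move: (usup x y) (uoo y); case: (u y) => // r.
rewrite -!EFinD lte_fin => uxy _ cr; apply: le_trans uxy.
by rewrite lee_fin; lra.
Qed.

(** By contraposition: a neighbourhood on which [u] has negative mass and one on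
which [v] does intersect in one on which the maximum does. *)
Lemma martin_mu_max u v eta :
  0 <= martin_mu A b (fun x => maxe (u x) (v x)) eta ->
  0 <= martin_mu A b u eta \/ 0 <= martin_mu A b v eta.
Proof.
move=> mu0; case: (leP 0 (martin_mu A b u eta)) => [|/ereal_inf_lt].
  by left.
move=> [_ [U Un <-] Uu]; right; rewrite leNgt; apply/negP => /ereal_inf_lt.
move=> [_ [U' Un' <-] Uv].
move: mu0; rewrite leNgt => /negP; apply.
pose mass w B := ereal_sup
  [set kernel_star A b x + w x | x in [set x | B (martin_column A b x)]].
apply: (@le_lt_trans _ _ (maxe (mass u U) (mass v U'))).
  apply: ge_ereal_inf; exists (mass (fun x => maxe (u x) (v x)) (U `&` U')).
    by exists (U `&` U') => //; exact: filterI.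
  apply/ereal_supP => _ [x [Ux U'x] <-]; rewrite le_max.
  have [uv|vu] := leP (u x) (v x).
    by apply/orP; right; apply: ereal_sup_ubound; exists x.
  by apply/orP; left; apply: ereal_sup_ubound; exists x.
by rewrite gt_max Uu Uv.
Qed.

Lemma minimal_boundary_extremal eta : minimal_boundary A b eta ->
  extremal_generator (maxplus_harmonic A) eta.
Proof.
move=> [etaM etaH mu0]; split=> // u v uH vH euv.
have /martin_mu_max : 0 <= martin_mu A b (fun x => maxe (u x) (v x)) eta.
  by rewrite -euv; rewrite /martin_H in mu0; rewrite mu0.
have leu x : u x <= (eta x)%:E.
  by rewrite [leRHS](congr1 (fun h => h x) euv) le_max lexx.
have lev x : v x <= (eta x)%:E.
  by rewrite [leRHS](congr1 (fun h => h x) euv) le_max lexx orbT.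
case=> [muu|muv]; [left|right]; apply/funext => x; apply/eqP; rewrite eq_le /=.
  rewrite leu andbT; apply: superharmonic_ge_mu muu _; first exact: uH.1.
  exact: harmonic_superharmonic.
rewrite lev andbT; apply: superharmonic_ge_mu muv _; first exact: vH.1.
exact: harmonic_superharmonic.
Qed.

(** The neighbourhoods of [eta] squeeze [f] onto [eta]: on the one hand they see
the value [f b = 0], so [f] has mass [0] at [eta]; on the other hand the values
of [f] are recovered from [K(x, .)] near [eta] and weights [a b y + f y <= 0]. *)
Lemma determined_everywhere_minimal f eta : maxplus_harmonic A (EFin \o f) ->
  normalised b f -> martin_space A b eta ->
  (forall U, nbhs eta U -> determined f [set y | U (martin_column A b y)]) ->
  minimal_boundary A b f.
Proof.
move=> fH fb etaM fdet.
have mu0 : martin_mu A b (EFin \o f) eta = 0.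
  apply/eqP; rewrite eq_le; apply/andP; split.
    apply: ge_ereal_inf; eexists; first by exists setT => //; exact: filterT.
    apply/ereal_supP => _ [y _ <-]; rewrite kernel_starE /= -EFinD lee_fin.
    by rewrite -fb; exact: harmonic_real_le.
  apply: le_ereal_inf_tmp => _ [U Un <-]; apply/lee_subgt0Pr => e e0.
  have [|y Uy ye] := fdet _ Un b (- e)%R.
    by rewrite /= fb lte_fin; lra.
  have /= cU := Uy (subset_closure (ex_intro2 _ _ y I erefl)).
  rewrite add0e; apply: le_trans (ereal_sup_ubound _); last by exists y.
  by rewrite kernel_starE /= -EFinD lee_fin ltW.
suff ef : f = eta :> (X -> R) by rewrite -ef in etaM mu0; split.
apply/funext => x; apply/eqP; rewrite eq_le; apply/andP; split; last first.
  rewrite -lee_fin; apply: (@superharmonic_ge_mu (EFin \o f)) => //.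
  - exact: harmonic_superharmonic.
  - by rewrite mu0.
apply/ler_addgt0Pl => e e0.
have [||y] := fdet [set h : {ptws X -> R} | (h x < eta x + e / 2)%R] _
  x (f x - e / 2)%R.
- by apply: eval_nbhs_lt; lra.
- by rewrite lte_fin; lra.
rewrite /= martin_columnE => yx cy.
by have := harmonic_real_le b y fH; rewrite fb; lra.
Qed.

Lemma extremal_minimal_boundary f :
  extremal_generator (maxplus_harmonic A) f -> normalised b f ->
  minimal_boundary A b f.
Proof.
move=> fext fb; have fH := fext.1.
(* Stability under intersection is exactly [extremal_determined]; properness
   holds because the whole space determines [f], and the whole space belongs to
   [F] because the empty set does not determine the finite function [f]. *)
pose F : set_system X := [set V | ~ determined f (~` V)].
have FF : ProperFilter F.
  split.
    apply; rewrite setC0 => x c; rewrite lte_fin => cx.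
    by exists x; rewrite // star_diag add0r.
  split.
  - rewrite /F /= setCT => /(_ b (f b - 1)%R); rewrite lte_fin.
    by case => [|? []]; lra.
  - by move=> V U FV FU; rewrite /F /= setCI => /(extremal_determined fext)[].
  - move=> V U VU FV fW; apply: FV => x c /fW[y nUy cy]; exists y => //.
    by move=> /VU.
have [eta etaM etaF] := martin_column_cluster FF.
apply: (@determined_everywhere_minimal f eta) => // U /etaF/contrapT.
by congr (determined f _); apply/seteqP; split=> y /=; rewrite notK.
Qed.

End Martin.

End Semigroup.

Theorem theorem3p15 (R : realType) (X : Type) (b : X)
    (A : R -> X -> X -> \bar R)
    (semigroupA : maxplus_semigroup A)
    (finA : forall x y : X, kernel_star A x y \is a fin_num)
    (pathA : forall (t : R) (x y : X), (0 <= t)%R ->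
      A t x y = ereal_sup [set path_reward A 0%R t gamma |
                            gamma in [set gamma : R -> X |
                                       gamma 0%R = x /\ gamma t = y]]) :
  [set f : X -> R | extremal_generator (maxplus_harmonic A) f /\ normalised b f]
  = minimal_boundary A b.
Proof.
apply/seteqP; split=> f.
  by move=> [fext fb]; exact: extremal_minimal_boundary.
move=> fM; split; first exact: minimal_boundary_extremal fM.
by case: fM => fM _ _; exact: martin_space_normalised fM.
Qed.
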